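(* Let $d\ge2$ and $n_0\in\mathbb{N}$. If $f\in H_{n_0,2d}$ is a strictly positive polynomial in the boundary of $\Sigma_{n_0,2d}$ and $f$ is a sum of squares of $s=\dim H_{n_0,d}-k$ linearly independent polynomials (in $H_{n_0,d}$), for some $k\ge0$, then for any $n>n_0$ there exists a strictly positive polynomial $g$ in the boundary of $\Sigma_{n,2d}$ that is the sum of squares of $\dim H_{n,d}-k$ linearly independent polynomials (in $H_{n,d}$).
   Context: $H_{n,d}$ denotes the real vector space of homogeneous polynomials of degree $d$ in $n$ variables with coefficients in $\mathbb{R}$. $\Sigma_{n,2d}\subset H_{n,2d}$ is the convex cone of finite sums of squares of polynomials in $H_{n,d}$; its boundary is taken in $H_{n,2d}$. A polynomial $f\in H_{n,2d}$ is strictly positive if $f(x)>0$ for all $x\in\mathbb{R}^n\setminus\{0\}$. *)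

(* Defs.v *)
From HB Require Import structures.
From mathcomp Require Import all_boot all_order all_algebra.
From mathcomp Require Import classical_sets reals topology.
From mathcomp Require Import mpoly.

Set Implicit Arguments.
Unset Strict Implicit.
Unset Printing Implicit Defensive.

Import GRing.Theory.
Import VectorInternalTheory.
Import numFieldTopology.Exports.

Local Open Scope classical_set_scope.
Local Open Scope ring_scope.

(* H_{n,d}.  The type [dhomog n R d] carries a vector space structure in mpoly
   only when n is a successor; [homogpoly] is a copy of it that has one for
   every n. *)
Definition homogpoly (R : realType) (n d : nat) : Type := dhomog n R d.

HB.instance Definition _ (R : realType) (n d : nat) :=
  GRing.Lmodule.copy (homogpoly R n d) (dhomog n R d).

Definition mpoly_of_homogpoly (R : realType) (n d : nat) (p : homogpoly R n d) :
  {mpoly R[n]} := mpoly_of_dhomog p.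

Coercion mpoly_of_homogpoly : homogpoly >-> mpoly.

Section HomogVector.
Variables (R : realType) (n d : nat).

Let b : seq 'X_{1..n} := [seq s2m t | t : d.-tuple 'I_n <- enum (basis n d)].

Let size_b : size b = #|basis n d|.
Proof. by rewrite size_map cardE. Qed.

Let f (p : homogpoly R n d) : 'rV[R]_#|basis n d| :=
  \row_i (p : {mpoly R[n]})@_(nth 0%MM b i).

Let g (r : 'rV[R]_#|basis n d|) : {mpoly R[n]} :=
  \sum_(i < #|basis n d|) r 0 i *: 'X_[nth 0%MM b i].

Let g_homog (r : 'rV[R]_#|basis n d|) : g r \is d.-homog.
Proof.
rewrite rpred_sum //= => i _; apply/rpredZ.
by rewrite dhomogX basis_cover mem_nth // size_b.
Qed.

Lemma homogpoly_vecaxiom : Vector.axiom #|basis n d| (homogpoly R n d).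
Proof.
exists f.
  by move=> c p q; apply/rowP=> i; rewrite !mxE [LHS]mcoeffD mcoeffZ.
have gE r (i : 'I_#|basis n d|) : (g r)@_(nth 0%MM b i) = r 0 i.
  rewrite /g raddf_sum /= (bigD1 i) //= mcoeffZ mcoeffX eqxx mulr1 big1 ?addr0 //.
  move=> j neji; rewrite mcoeffZ mcoeffX nth_uniq ?size_b ?uniq_basis //.
  by rewrite (inj_eq val_inj) (negbTE neji) mulr0.
exists (fun r => DHomog (g_homog r)) => [p|r]; last first.
  by apply/rowP=> i; rewrite mxE gE.
apply/val_inj/mpolyP => m /=.
have [m_b|m_b] := boolP (m \in b).
  have lt_m : (index m b < #|basis n d|)%N by rewrite -size_b index_mem.
  by have := gE (f p) (Ordinal lt_m); rewrite /= nth_index // mxE /= nth_index.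
move: (m_b); rewrite -basis_cover => degm.
by rewrite !(dhomog_nemf_coeff (mf := mdeg) (d := d)) //; apply: dhomog_is_dhomog.
Qed.

End HomogVector.

HB.instance Definition _ (R : realType) (n d : nat) :=
  Lmodule_hasFinDim.Build R (homogpoly R n d) (homogpoly_vecaxiom R n d).

(* The Euclidean topology of the finite-dimensional space H_{n,d}, transported
   along the linear isomorphism [v2r] with R^(dim H_{n,d}). *)
HB.instance Definition _ (R : realType) (n d : nat) :=
  Topological.copy (homogpoly R n d)
    (initial_topology (v2r : homogpoly R n d -> 'rV[R]_(dim (homogpoly R n d)))).

Definition boundary (T : topologicalType) (A : set T) : set T :=
  closure A `\` interior A.

Definition sum_of_squares (R : realType) (n d s : nat)
    (p : s.-tuple (homogpoly R n d)) : {mpoly R[n]} :=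
  \sum_(i < s) (tnth p i : {mpoly R[n]}) ^+ 2.

(* The cone Sigma_{n,2d} *)
Definition sos_cone (R : realType) (n d : nat) : set (homogpoly R n (2 * d)) :=
  [set f | exists s (p : s.-tuple (homogpoly R n d)),
    f = sum_of_squares p :> {mpoly R[n]}].

Arguments sos_cone : clear implicits.

Definition sos_of_free (R : realType) (n d s : nat)
    (f : homogpoly R n (2 * d)) : Prop :=
  exists p : s.-tuple (homogpoly R n d),
    free p /\ f = sum_of_squares p :> {mpoly R[n]}.

Definition strictly_positive (R : realType) (n d : nat)
    (f : homogpoly R n d) : Prop :=
  forall x : 'rV[R]_n, x != 0 -> 0 < (f : {mpoly R[n]}).@[x 0].

(* Main.v *)
Require Import Defs.
From HB Require Import structures.
From mathcomp Require Import all_boot all_order all_algebra.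
From mathcomp Require Import classical_sets reals topology.
From mathcomp Require Import mpoly.
From mathcomp Require Import boolp pseudometric_normed_Zmodule tvs.
From mathcomp Require normed_module matrix_normedtype.

(** Write n0 < n.  Setting the variables of index at least n0 to zero is a
    linear map [restrict] from H_{n,d} onto H_{n0,d}, with the inclusion
    [extend] as a section.  Let [kernel_squares] be the sum of the squares of a
    basis of the kernel of [restrict]; the polynomial wanted is
    g = extend f + kernel_squares.

    - If f is a sum of squares of dim H_{n0,d} - k independent polynomials, then
      their extensions together with the basis of the kernel are independent,
      because the image of [extend] meets the kernel trivially; their number is
      dim H_{n,d} - k by rank-nullity.
    - At a nonzero point whose first n0 coordinates do not all vanish, the
      extension of f is positive.  At any other nonzero point some coordinate x_j
      with n0 <= j is nonzero, and X_j^d lies in the kernel, so some basis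
      element of the kernel does not vanish there.
    - Restricting g gives back f, and restriction maps sums of squares to sums of
      squares.  So if g were interior to the cone, every h close to f, for which
      extend h + kernel_squares is close to g, would be a sum of squares too,
      and f would be interior. *)

Set Implicit Arguments.
Unset Strict Implicit.
Unset Printing Implicit Defensive.

Import Order.TTheory GRing.Theory Num.Theory.
Import VectorInternalTheory.
Import numFieldTopology.Exports.

Local Open Scope classical_set_scope.
Local Open Scope ring_scope.

(** * Affine maps between spaces of forms are continuous *)

Lemma continuous_entries (S T : topologicalType) (m n : nat)
    (f : S -> 'M[T]_(m, n)) :
  (forall i j, continuous (fun x => f x i j)) -> continuous f.
Proof.
move=> cf x U [P fP sPU]; rewrite /nbhs /=.
apply: filterS (_ : nbhs x (fun y => forall i j, P i j (f y i j))) => [y|].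
  exact: sPU.
by apply: filter_forall => i; apply: filter_forall => j; apply: cf.
Qed.

Lemma continuous_affine_row (R : realType) (m n : nat)
    (M : 'M[R]_(m, n)) (c : 'rV[R]_n) :
  continuous (fun x : 'rV[R]_m => x *m M + c).
Proof.
apply: continuous_entries => i j.
have -> : (fun x : 'rV[R]_m => (x *m M + c) i j) =
    (fun x => \sum_k M k j * x i k + c i j).
  apply/funext => x; rewrite !mxE; congr (_ + _).
  by apply: eq_bigr => k _; rewrite mulrC.
have coord_cont k : continuous (fun x : 'rV[R]_m => M k j * x i k).
  move=> x; apply: continuous_comp; last exact: normed_module.mulrl_continuous.
  exact: matrix_normedtype.coord_continuous.
have add_cont : continuous (fun z : R * R => z.1 + z.2).
  exact: (@add_continuous R^o).
move=> x; apply: (@cvgD R R^o _ (nbhs x)); last exact: cvg_cst.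
exact: (continuous_big (P := xpredT) add_cont (fun k _ => coord_cont k)).
Qed.

(** The topology of H_{n,d} is pulled back from coordinates, in which an affine
    map is a row vector multiplied by a matrix, plus a constant. *)
Lemma continuous_affine_homogpoly (R : realType) (m n d e : nat)
    (A : 'Hom(homogpoly R m d, homogpoly R n e)) (b : homogpoly R n e) :
  continuous (fun p : homogpoly R m d => A p + b).
Proof.
apply: continuous_comp_initial.
have -> : v2r \o (fun p => A p + b) =
    (fun x => x *m lin1_mx (v2r \o A \o r2v) + v2r b) \o v2r.
  by apply/funext=> p /=; rewrite linearD /= mul_rV_lin1 /= v2rK.
move=> p; apply: continuous_comp; first exact: initial_continuous.
exact: continuous_affine_row.
Qed.

(** * Substitution of linear forms *)

Lemma dhomog_var (R : comNzRingType) (n : nat) (i : 'I_n) :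
  ('X_i : {mpoly R[n]}) \is 1.-homog.
Proof. by rewrite dhomogX /= mdeg1. Qed.

Lemma dhomog_comp_mpoly (R : comNzRingType) (m n d : nat)
    (lq : m.-tuple {mpoly R[n]}) (p : {mpoly R[m]}) :
  (forall i, tnth lq i \is 1.-homog) -> p \is d.-homog ->
  p \mPo lq \is d.-homog.
Proof.
move=> lq1 /dhomogP pd; rewrite comp_mpolyE big_seq rpred_sum // => u /pd /= <-.
apply/rpredZ; rewrite mdegE.
apply: (big_rec2 (fun q k => q \is k.-homog)) => [|i k q _ qk].
  exact: dhomog1.
by apply: dhomogM => //; rewrite -[X in X.-homog]mul1n; apply: dhomogMn.
Qed.

Lemma comp_mpolyA (R : comNzRingType) (l m n : nat) (p : {mpoly R[l]})
    (lq : l.-tuple {mpoly R[m]}) (lr : m.-tuple {mpoly R[n]}) :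
  (p \mPo lq) \mPo lr = p \mPo [tuple tnth lq i \mPo lr | i < l].
Proof.
rewrite [RHS]comp_mpolyEX (comp_mpolyEX p) raddf_sum; apply: eq_bigr => u _ /=.
rewrite comp_mpolyZ !comp_mpolyX rmorph_prod /=; congr (_ *: _).
by apply: eq_bigr => i _; rewrite rmorphXn tnth_mktuple.
Qed.

Section LinearSubstitution.
Variables (R : realType) (m n d : nat) (lq : m.-tuple {mpoly R[n]}).
Hypothesis lq1 : forall i, tnth lq i \is 1.-homog.

Lemma linsubst_homog (p : homogpoly R m d) :
  (p : {mpoly R[m]}) \mPo lq \is d.-homog.
Proof. exact/dhomog_comp_mpoly/dhomog_is_dhomog. Qed.

Definition linsubst_fun (p : homogpoly R m d) : homogpoly R n d :=
  DHomog (linsubst_homog p).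

Lemma linsubst_fun_is_linear : linear linsubst_fun.
Proof. by move=> c p q; apply: val_inj; rewrite /= !linearP. Qed.

HB.instance Definition _ :=
  GRing.isLinear.Build R (homogpoly R m d) (homogpoly R n d) _ linsubst_fun
    linsubst_fun_is_linear.

Definition linsubst : 'Hom(homogpoly R m d, homogpoly R n d) :=
  linfun linsubst_fun.

Lemma linsubstE (p : homogpoly R m d) :
  mpoly_of_homogpoly (linsubst p) = mpoly_of_homogpoly p \mPo lq.
Proof. by rewrite lfunE. Qed.

End LinearSubstitution.

(** * Sums of squares of forms *)

Lemma sum_of_squaresE (R : realType) (n d s : nat)
    (ps : s.-tuple (homogpoly R n d)) :
  sum_of_squares ps = \sum_(p <- ps) (p : {mpoly R[n]}) ^+ 2.
Proof. by rewrite /sum_of_squares [RHS]big_tuple. Qed.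

Lemma dhomog_sum_of_squares (R : realType) (n d : nat)
    (ps : seq (homogpoly R n d)) :
  \sum_(p <- ps) (p : {mpoly R[n]}) ^+ 2 \is (2 * d).-homog.
Proof.
apply: rpred_sum => p _; rewrite mulnC; apply: dhomogMn.
exact: dhomog_is_dhomog.
Qed.

(** A substitution is a ring morphism, so it maps squares to squares. *)
Lemma sos_cone_linsubst (R : realType) (m n d : nat)
    (lq : m.-tuple {mpoly R[n]}) (lq1 : forall i, tnth lq i \is 1.-homog)
    (h : homogpoly R m (2 * d)) :
  sos_cone R m d h -> sos_cone R n d (linsubst (2 * d) lq1 h).
Proof.
case=> s [ps hps]; exists s, [tuple linsubst d lq1 (tnth ps i) | i < s].
rewrite linsubstE hps rmorph_sum; apply: eq_bigr => i _.
by rewrite rmorphXn tnth_mktuple linsubstE.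
Qed.

Lemma meval_sum_squares (R : realType) (n d : nat) (v : 'I_n -> R)
    (ps : seq (homogpoly R n d)) :
  (\sum_(p <- ps) mpoly_of_homogpoly p ^+ 2).@[v] =
  \sum_(p <- ps) (mpoly_of_homogpoly p).@[v] ^+ 2.
Proof. by rewrite rmorph_sum; apply: eq_bigr => p _; rewrite rmorphXn. Qed.

Lemma meval_sum_squares_ge0 (R : realType) (n d : nat) (v : 'I_n -> R)
    (ps : seq (homogpoly R n d)) :
  0 <= (\sum_(p <- ps) mpoly_of_homogpoly p ^+ 2).@[v].
Proof. by rewrite meval_sum_squares sumr_ge0 // => p _; apply: sqr_ge0. Qed.

(** If all the ps vanished at v, then so would every form in their span. *)
Lemma meval_sum_squares_gt0 (R : realType) (n d : nat) (v : 'I_n -> R)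
    (ps : seq (homogpoly R n d)) (q : homogpoly R n d) :
  q \in <<ps>>%VS -> (mpoly_of_homogpoly q).@[v] != 0 ->
  0 < (\sum_(p <- ps) mpoly_of_homogpoly p ^+ 2).@[v].
Proof.
move=> /(@coord_span _ _ _ (in_tuple ps)) -> qv_neq0.
rewrite meval_sum_squares lt_def sumr_ge0 ?andbT => [|p _]; last exact: sqr_ge0.
apply: contra_neq qv_neq0 => /eqP; rewrite psumr_eq0 => [/allP ps0|p _]; last first.
  exact: sqr_ge0.
(* Evaluation at v, packed as a linear form on H_{n,d}, is applied to the
   expansion of q on the ps. *)
have mevalP : linear_for *%R (fun p : homogpoly R n d =>
    (mpoly_of_homogpoly p).@[v]).
  by move=> c p1 p2; rewrite /mpoly_of_homogpoly /= !linearP.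
pose ev := GRing.isLinear.Build R (homogpoly R n d) R _ _ mevalP.
pose L : {linear homogpoly R n d -> R | *%R} := HB.pack (fun p : homogpoly R n d =>
    (mpoly_of_homogpoly p).@[v]) ev.
rewrite -[LHS]/(L _) linear_sum big1 // => i _; rewrite linearZ /=.
have /ps0 : (in_tuple ps)`_i \in ps by rewrite mem_nth.
by rewrite sqrf_eq0 /= => /eqP ->; rewrite mulr0.
Qed.

(** * Bases adapted to a retraction *)

Lemma free_map_ker0 (K : fieldType) (U V : vectType K) (A : 'Hom(U, V))
    (X : seq U) :
  lker A == 0%VS -> free X -> free (map A X).
Proof.
move=> /eqP kerA freeX.
apply: (@basis_free _ _ (A @: <<X>>)%VS); apply: limg_basis_of.
  by rewrite kerA capv0.
by rewrite /basis_of eqxx.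
Qed.

Section Retraction.
Variables (K : fieldType) (U V : vectType K).
Variables (A : 'Hom(U, V)) (B : 'Hom(V, U)).
Hypothesis AK : cancel A B.

(** A vector A u of the kernel of B is zero, since u = B (A u) = 0: the image of
    the section A is independent of the kernel. *)
Lemma free_section_cat_ker (X : seq U) (Y : seq V) :
  free X -> basis_of (lker B) Y -> free (map A X ++ Y).
Proof.
move=> freeX basY; rewrite cat_free (basis_free basY) (span_basis basY).
rewrite free_map_ker0 //=; last by apply/lker0P; apply: can_inj AK.
rewrite -limg_span; apply/directv_addP/eqP; rewrite -subv0; apply/subvP => v.
rewrite memv_cap memv_ker => /andP[/memv_imgP[u _ ->]]; rewrite AK => /eqP ->.
by rewrite linear0 mem0v.
Qed.

Lemma dim_lker_retraction : (\dim {:U} + \dim (lker B) = \dim {:V})%N.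
Proof.
have <- : limg B = fullv.
  apply/eqP; rewrite eqEsubv subvf; apply/subvP => u _.
  by rewrite -[u]AK memv_img ?memvf.
by rewrite addnC -(limg_ker_dim B fullv) capfv.
Qed.

End Retraction.

(** * Adding variables to a form *)

Section AddVariables.
Variables (R : realType) (n0 n : nat).
Hypothesis le_n0n : (n0 <= n)%N.

Definition old_vars : n0.-tuple {mpoly R[n]} :=
  [tuple 'X_(widen_ord le_n0n i) | i < n0].

Definition vars_or_zero : n.-tuple {mpoly R[n0]} :=
  [tuple oapp (fun j : 'I_n0 => 'X_j) 0 (insub (val i)) | i < n].

Lemma old_vars_homog i : tnth old_vars i \is 1.-homog.
Proof. by rewrite tnth_mktuple dhomog_var. Qed.

Lemma vars_or_zero_homog i : tnth vars_or_zero i \is 1.-homog.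
Proof.
rewrite tnth_mktuple; case: insubP => [j _ _|_] /=; last exact: dhomog0.
exact: dhomog_var.
Qed.

Definition extend d : 'Hom(homogpoly R n0 d, homogpoly R n d) :=
  linsubst d old_vars_homog.

Definition restrict d : 'Hom(homogpoly R n d, homogpoly R n0 d) :=
  linsubst d vars_or_zero_homog.

Lemma extendE d (p : homogpoly R n0 d) :
  mpoly_of_homogpoly (extend d p) = mpoly_of_homogpoly p \mPo old_vars.
Proof. exact: linsubstE. Qed.

Lemma restrictE d (p : homogpoly R n d) :
  mpoly_of_homogpoly (restrict d p) = mpoly_of_homogpoly p \mPo vars_or_zero.
Proof. exact: linsubstE. Qed.

(** The composite substitution fixes each old variable. *)
Lemma extendK d : cancel (extend d) (restrict d).
Proof.
move=> p; apply: val_inj; rewrite [LHS]restrictE extendE comp_mpolyA.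
rewrite -[RHS]comp_mpoly_id; congr (_ \mPo _).
apply: eq_from_tnth => i; rewrite !tnth_mktuple comp_mpolyXU -tnth_nth.
rewrite tnth_mktuple /= insubT //= => lt_i; congr 'X_(_); exact: val_inj.
Qed.

(** Such powers are what detects, among the forms of the kernel, the points whose
    first n0 coordinates vanish. *)
Lemma new_var_exp_ker d (j : 'I_n) : (0 < d)%N -> (n0 <= j)%N ->
  exists2 q : homogpoly R n d, q \in lker (restrict d) &
    mpoly_of_homogpoly q = 'X_j ^+ d.
Proof.
move=> d_gt0 le_n0j.
have Xd : ('X_j ^+ d : {mpoly R[n]}) \is d.-homog.
  by rewrite -[X in X.-homog]mul1n dhomogMn // dhomog_var.
exists (DHomog Xd) => //; rewrite memv_ker; apply/eqP/val_inj.
rewrite [LHS]restrictE /= rmorphXn /= comp_mpolyXU -tnth_nth tnth_mktuple.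
by rewrite insubF ?ltnNge ?le_n0j //= expr0n eqn0Ngt d_gt0.
Qed.

Variable d : nat.

Definition kernel_basis : seq (homogpoly R n d) := vbasis (lker (restrict d)).

Lemma kernel_basisP : basis_of (lker (restrict d)) kernel_basis.
Proof. exact: vbasisP. Qed.

Definition kernel_squares : homogpoly R n (2 * d) :=
  DHomog (dhomog_sum_of_squares kernel_basis).

Lemma restrict_kernel_squares : restrict (2 * d) kernel_squares = 0.
Proof.
apply/val_inj; rewrite [LHS]restrictE /= rmorph_sum big1_seq // => q /andP[_ q_b].
have : q \in lker (restrict d) by rewrite (basis_mem kernel_basisP).
rewrite memv_ker rmorphXn /= => /eqP/(congr1 (@mpoly_of_homogpoly _ _ _)).
by rewrite restrictE => ->; rewrite expr0n.
Qed.

Definition add_kernel_squares (h : homogpoly R n0 (2 * d)) :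
    homogpoly R n (2 * d) := extend (2 * d) h + kernel_squares.

Lemma add_kernel_squaresE h :
  mpoly_of_homogpoly (add_kernel_squares h) =
  mpoly_of_homogpoly h \mPo old_vars +
  \sum_(q <- kernel_basis) mpoly_of_homogpoly q ^+ 2.
Proof. by rewrite -extendE. Qed.

Lemma restrict_add_kernel_squares : cancel add_kernel_squares (restrict (2 * d)).
Proof. by move=> h; rewrite linearD /= extendK restrict_kernel_squares addr0. Qed.

(** The extensions of the old polynomials and the basis of the kernel form a free
    family, and rank-nullity for [restrict] counts it. *)
Lemma sos_of_free_add_kernel_squares k (f : homogpoly R n0 (2 * d)) :
  (k <= \dim {:homogpoly R n0 d})%N ->
  sos_of_free (\dim {:homogpoly R n0 d} - k) f ->
  sos_of_free (\dim {:homogpoly R n d} - k) (add_kernel_squares f).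
Proof.
move=> le_k [ps [ps_free f_ps]].
pose qs := map (extend d) ps ++ kernel_basis.
have <- : size qs = (\dim {:homogpoly R n d} - k)%N.
  rewrite size_cat size_map !size_tuple.
  by rewrite -(dim_lker_retraction (@extendK d)) addnBAC.
exists (in_tuple qs); split.
  exact: (free_section_cat_ker (@extendK d) ps_free kernel_basisP).
rewrite [LHS]add_kernel_squaresE sum_of_squaresE big_cat big_map /=; congr (_ + _).
rewrite [mpoly_of_homogpoly f]f_ps sum_of_squaresE rmorph_sum.
by apply: eq_bigr => p _; rewrite rmorphXn extendE.
Qed.

Lemma strictly_positive_add_kernel_squares (f : homogpoly R n0 (2 * d)) :
  (0 < d)%N -> sos_cone R n0 d f -> strictly_positive f ->
  strictly_positive (add_kernel_squares f).
Proof.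
move=> d_gt0 [s [ps f_ps]] f_pos x x_neq0.
rewrite [mpoly_of_homogpoly _]add_kernel_squaresE mevalD comp_mpoly_meval.
pose y := \row_(i < n0) x 0 (widen_ord le_n0n i).
(* y is the projection of x on its first n0 coordinates. *)
rewrite (@meval_eq _ _ _ (y 0)); last first.
  by move=> i; rewrite tnth_mktuple mevalXU mxE.
have [y0|y_neq0] := eqVneq y 0; last first.
  by rewrite ltr_wpDr ?meval_sum_squares_ge0 //; apply: f_pos.
rewrite ltr_wpDl //.
  by rewrite [mpoly_of_homogpoly f]f_ps sum_of_squaresE meval_sum_squares_ge0.
have [j xj_neq0] : exists j, x 0 j != 0.
  apply/existsP; apply: contra_neqT x_neq0 => /existsPn x0.
  by apply/rowP => j; rewrite mxE; apply/eqP/negbNE.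
have le_n0j : (n0 <= j)%N.
  rewrite leqNgt; apply: contra_neqN xj_neq0 => lt_jn0.
  have := congr1 (fun z : 'rV_n0 => z 0 (Ordinal lt_jn0)) y0.
  by rewrite !mxE => <-; congr (x 0 _); apply: val_inj.
have [q qK qE] := new_var_exp_ker d_gt0 le_n0j.
apply: (@meval_sum_squares_gt0 _ _ _ _ _ q).
  by rewrite (span_basis kernel_basisP).
by rewrite qE rmorphXn /= mevalXU expf_neq0.
Qed.

(** [add_kernel_squares] is continuous, so it pulls a neighbourhood of its value
    at f inside the larger cone back to a neighbourhood of f, which restriction
    shows to lie inside the smaller cone. *)
Lemma interior_add_kernel_squares (f : homogpoly R n0 (2 * d)) :
  interior (sos_cone R n d) (add_kernel_squares f) ->
  interior (sos_cone R n0 d) f.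
Proof.
move=> int_g.
have : nbhs f (add_kernel_squares @^-1` sos_cone R n d).
  exact: continuous_affine_homogpoly int_g.
apply: filterS => h /= /(sos_cone_linsubst vars_or_zero_homog).
by rewrite -/(restrict (2 * d)) restrict_add_kernel_squares.
Qed.

End AddVariables.

Theorem corollary4p2 (R : realType) (d n0 k : nat) (hd : (2 <= d)%N)
    (hk : (k <= \dim {:homogpoly R n0 d})%N)
    (f : homogpoly R n0 (2 * d))
    (f_pos : strictly_positive f)
    (f_bd : boundary (sos_cone R n0 d) f)
    (f_sos : sos_of_free (\dim {:homogpoly R n0 d} - k) f)
    (n : nat) (hn : (n0 < n)%N) :
  exists g : homogpoly R n (2 * d),
    [/\ strictly_positive g,
        boundary (sos_cone R n d) g
      & sos_of_free (\dim {:homogpoly R n d} - k) g].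
Proof.
have le_n0n := ltnW hn; have d_gt0 : (0 < d)%N := ltnW hd.
have g_sos := sos_of_free_add_kernel_squares le_n0n hk f_sos.
exists (add_kernel_squares le_n0n f); split=> //.
- apply: strictly_positive_add_kernel_squares => //.
  by have [ps [_ f_ps]] := f_sos; exists _, ps.
- case: f_bd => _ f_int; split.
    by apply: subset_closure; have [qs [_ g_qs]] := g_sos; exists _, qs.
  by move=> /interior_add_kernel_squares.
Qed.
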